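(* Let $\mathcal F$ be a class of measurable functions $f:\mathbb R^p\to\mathbb R$ with a bounded envelope function. Suppose that either of the following conditions is satisfied: (i) $\mathrm Q_n\rightsquigarrow\mathrm P$ in $\mathrm P_{\mathcal O}$-probability and every $f\in\mathcal F$ is $\mathrm P$-a.s. continuous (i.e. its set of discontinuity points has $\mathrm P$-measure zero); (ii) $\mathrm Q_n\rightsquigarrow\mathrm P$ in $\mathrm P_{\mathcal O}$-probability, and there exists a deterministic finite Borel measure $\nu$ on $\mathbb R^p$ such that $\mathrm P\ll\nu$ and, for every $\epsilon>0$, $$\lim_{\delta\downarrow0}\limsup_{n\to\infty}\mathrm P_{\mathcal O}\Big(\sup_{A:\ \nu(A)\le\delta}\mathrm Q_n(A)>\epsilon\Big)=0,$$ where the supremum is over all Borel sets $A$. Then, for every $f,g\in\mathcal F$, $$\mathrm Q_n[fg]-\mathrm Q_n[f]\mathrm Q_n[g]=\mathrm P[fg]-\mathrm P[f]\mathrm P[g]+o_{\mathrm P_{\mathcal O}}(1).$$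
   Context: $\mathrm P$ is a Borel probability measure on $\mathbb R^p$ (the data distribution). For each $n$, $\mathrm Q_n$ is a random Borel probability measure on $\mathbb R^p$ (the learned law $\hat G_n\#\mathrm P_U$, the pushforward of a known base distribution $\mathrm P_U$ by a fitted generator $\hat G_n$), whose randomness comes from the fitting information $\mathcal O$ (a $\sigma$-field depending on $n$, including the data and training randomness); $\mathrm P_{\mathcal O}$ is the probability measure governing $\mathcal O$. For a measure $\mu$, $\mu f=\mu[f]=\int f\,d\mu$. $o_{\mathrm P_{\mathcal O}}(1)$ denotes convergence to $0$ in $\mathrm P_{\mathcal O}$-probability as $n\to\infty$. A bounded envelope means a function $F$ bounded by a finite constant with $|f|\le F$ for all $f\in\mathcal F$. ''$\mathrm Q_n\rightsquigarrow\mathrm P$ in $\mathrm P_{\mathcal O}$-probability'' means $(\mathrm Q_n-\mathrm P)h=o_{\mathrm P_{\mathcal O}}(1)$ for every bounded continuous $h:\mathbb R^p\to\mathbb R$. Standard measurability conditions are imposed so that all quantities (including suprema) are measurable. *)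

(* Defs.v *)
From HB Require Import structures.
From mathcomp Require Import all_boot all_order all_algebra.
From mathcomp Require Import all_classical all_reals all_analysis.
From mathcomp Require Import measurable_realfun.
Set Implicit Arguments.
Unset Strict Implicit.
Unset Printing Implicit Defensive.
Import Order.TTheory GRing.Theory Num.Theory.
Import numFieldNormedType.Exports.
Local Open Scope classical_set_scope.
Local Open Scope ring_scope.

(* R^p with its Borel sigma-algebra.  The type is convertible to ['rV[R]_p],
   which carries the (product) topology; the alias only carries the
   measurable structure. *)
Definition borelRp (R : realType) (p : nat) :=
  g_sigma_algebraType (@open 'rV[R]_p).

(* X_n = o(1) in probability, where each X_n lives on its own probability
   space (Om n, PO n). *)
Definition oP1 (R : realType) (d : nat -> measure_display)
    (Om : forall n, measurableType (d n))
    (PO : forall n, probability (Om n) R)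
    (X : forall n, Om n -> R) : Prop :=
  forall eps : R, 0 < eps ->
    (fun n => PO n [set w | eps < `|X n w|]) @ \oo --> 0%E.

Definition bounded_envelope (T : Type) (R : realType)
    (F : set (T -> R)) : Prop :=
  exists2 E : T -> R,
    (exists M : R, forall x, `|E x| <= M) &
    (forall f, F f -> forall x, `|f x| <= E x).

Definition weak_cvg_in_prob (R : realType) (p : nat)
    (d : nat -> measure_display)
    (Om : forall n, measurableType (d n))
    (PO : forall n, probability (Om n) R)
    (Q : forall n, R.-pker (Om n) ~> borelRp R p)
    (P : probability (borelRp R p) R) : Prop :=
  forall h : 'rV[R]_p -> R, continuous h ->
    (exists M : R, forall x, `|h x| <= M) ->
    oP1 PO (fun n w => \int[Q n w]_x h x - \int[P]_x h x).

(* sup { m(A) : A Borel, nu(A) <= delta }; the index set contains set0. *)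
Definition sup_small (R : realType) (d : measure_display)
    (T : measurableType d) (nu m : {measure set T -> \bar R})
    (delta : R) : \bar R :=
  ereal_sup [set m A | A in [set A | measurable A /\ (nu A <= delta%:E)%E]].

(* The measurability clause is what makes the probability below meaningful:
   an uncountable supremum of random variables need not be measurable. *)
Definition unif_abs_cont_in_prob (R : realType) (p : nat)
    (d : nat -> measure_display)
    (Om : forall n, measurableType (d n))
    (PO : forall n, probability (Om n) R)
    (Q : forall n, R.-pker (Om n) ~> borelRp R p)
    (nu : {finite_measure set (borelRp R p) -> \bar R}) : Prop :=
  (forall n (delta : R), 0 < delta ->
     measurable_fun setT (fun w => sup_small nu (Q n w) delta)) /\
  (forall eps : R, 0 < eps ->
     (fun delta : R => limn_esup (fun n =>
        PO n [set w | (eps%:E < sup_small nu (Q n w) delta)%E]))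
     @ 0^'+ --> 0%E).

(* Main.v *)
(* It suffices to show [Q_n f - P f = o(1)] in probability for every bounded
   measurable [f] as in (i) or (ii): apply this to [f], [g] and [f g].

   (i) The Lipschitz envelopes [l_k x = inf_y (f y + k |x - y|)] and
   [u_k x = sup_y (f y - k |x - y|)] are bounded and continuous, satisfy
   [l_k <= f <= u_k], and both converge to [f] at the continuity points of [f].
   Hence [P (u_k - l_k)] is small for large [k], and [Q_n f] is squeezed between
   [Q_n l_k] and [Q_n u_k].

   (ii) By Lusin's theorem for the finite measure [nu + P], there is a bounded
   continuous [h], with the same bound as [f], which is uniformly close to [f]
   off a set [B] such that [nu B] and [P B] are both at most [delta]; the
   hypothesis on [nu] controls [Q_n B]. *)
Require Import Defs.
From HB Require Import structures.
From mathcomp Require Import all_boot all_order all_algebra.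
From mathcomp Require Import all_classical all_reals all_analysis.
From mathcomp Require Import measurable_realfun.
From mathcomp Require Import lra ring.
Set Implicit Arguments.
Unset Strict Implicit.
Unset Printing Implicit Defensive.
Import Order.TTheory GRing.Theory Num.Theory.
Import numFieldNormedType.Exports.
Local Open Scope classical_set_scope.
Local Open Scope ring_scope.

(** * Lower Lipschitz envelopes *)

(** For [f] bounded below and [k >= 0] this is the largest [k]-Lipschitz minorant of [f]. The upper
    envelope of [f] is recovered as [- lip_env k (- f)], so only the lower one is studied. *)
Definition lip_env (R : realType) (V : normedModType R) (k : R) (f : V -> R)
    (x : V) : R :=
  inf (range (fun y => f y + k * `|x - y|)).

Lemma lip_env_lbound (R : realType) (V : normedModType R) (k m : R)
    (f : V -> R) (x : V) : 0 <= k -> (forall y, m <= f y) ->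
  lbound (range (fun y => f y + k * `|x - y|)) m.
Proof. by move=> k0 fm _ [y _ <-]; rewrite ler_wpDr// mulr_ge0. Qed.

Lemma lip_env_le (R : realType) (V : normedModType R) (k m : R)
    (f : V -> R) (x y : V) : 0 <= k -> (forall y, m <= f y) ->
  lip_env k f x <= f y + k * `|x - y|.
Proof.
by move=> k0 fm; apply: ge_inf; [exists m; exact: lip_env_lbound|exists y].
Qed.

Lemma lip_env_lef (R : realType) (V : normedModType R) (k m : R)
    (f : V -> R) (x : V) : 0 <= k -> (forall y, m <= f y) ->
  lip_env k f x <= f x.
Proof.
move=> k0 fm; rewrite (le_trans (lip_env_le x x k0 fm))//.
by rewrite subrr normr0 mulr0 addr0.
Qed.

Lemma lip_env_ge (R : realType) (V : normedModType R) (k c : R)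
    (f : V -> R) (x : V) :
  (forall y, c <= f y + k * `|x - y|) -> c <= lip_env k f x.
Proof.
move=> h; apply: lb_le_inf; first by exists (f x + k * `|x - x|), x.
by move=> _ [y _ <-]; exact: h.
Qed.

Lemma lip_env_gem (R : realType) (V : normedModType R) (k m : R)
    (f : V -> R) (x : V) : 0 <= k -> (forall y, m <= f y) -> m <= lip_env k f x.
Proof.
by move=> k0 fm; apply: lip_env_ge => y; rewrite ler_wpDr// mulr_ge0.
Qed.

Lemma lip_env_homo (R : realType) (V : normedModType R) (k l m : R)
    (f : V -> R) (x : V) : 0 <= k -> k <= l -> (forall y, m <= f y) ->
  lip_env k f x <= lip_env l f x.
Proof.
move=> k0 kl fm; apply: lip_env_ge => y.
by rewrite (le_trans (lip_env_le x y k0 fm))// lerD2l ler_wpM2r.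
Qed.

(** By the triangle inequality the competitors [f y + k * |u - y|] and [f y + k * |v - y|] differ by
    at most [k * |u - v|], uniformly in [y]; hence so do their infima. *)
Lemma lip_env_lip (R : realType) (V : normedModType R) (k m : R)
    (f : V -> R) (x z : V) : 0 <= k -> (forall y, m <= f y) ->
  `|lip_env k f x - lip_env k f z| <= k * `|x - z|.
Proof.
move=> k0 fm.
have H u v : lip_env k f u - k * `|u - v| <= lip_env k f v.
  apply: lip_env_ge => y; rewrite lerBlDr -addrA -mulrDr.
  rewrite (le_trans (lip_env_le u y k0 fm))// lerD2l ler_wpM2l//.
  by rewrite [leRHS]addrC; exact: ler_distD.
by rewrite ler_distlC H/= -lerBlDr distrC H.
Qed.

Lemma lip_env_continuous (R : realType) (V : normedModType R) (k m : R)
    (f : V -> R) : 0 <= k -> (forall y, m <= f y) -> continuous (lip_env k f).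
Proof.
move=> k0 fm x; apply/cvgrPdist_lt => e e0; near=> z.
rewrite (le_lt_trans (lip_env_lip x z k0 fm))//.
rewrite (@le_lt_trans _ _ ((k + 1) * `|x - z|))//.
  by rewrite ler_wpM2r// lerDl.
rewrite -ltr_pdivlMl; last lra.
near: z; apply: (@cvgr_dist_lt _ V _ (nbhs x) _ id); first exact: cvg_id.
by rewrite mulr_gt0// invr_gt0; lra.
Unshelve. all: by end_near. Qed.

(** Points within [r] of [x] contribute at least [c] by assumption; for the others the penalty
    [k * r] lifts the global lower bound [m] up to [c]. This yields convergence of the envelopes at
    continuity points. *)
Lemma lip_env_ge_near (R : realType) (V : normedModType R) (k m c r : R)
    (f : V -> R) (x : V) : 0 <= k -> (forall y, m <= f y) ->
  (forall y, `|x - y| < r -> c <= f y) -> c - m <= k * r ->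
  c <= lip_env k f x.
Proof.
move=> k0 fm fc cmr; apply: lip_env_ge => y.
have [xyr|rxy] := ltP `|x - y| r; first by rewrite ler_wpDr ?mulr_ge0// fc.
have := ler_wpM2l k0 rxy; have := fm y; lra.
Qed.

(** * Measurability and integrals of bounded functions *)

Lemma continuous_borelRp_measurable (R : realType) (p : nat)
    (h : 'rV[R]_p -> R) : continuous h -> measurable_fun [set: borelRp R p] h.
Proof.
move=> /continuousP ch.
apply: (@measurability _ _ (borelRp R p) R setT h _
  (RGenOpens.measurableE R)) => _ [_ [a [b ->] <-]].
by rewrite setTI; apply: sub_gen_smallest; exact/ch/interval_open.
Qed.

(** Here and below, [mu] is a plain measure with the equation [mu setT = 1], so that the results
    apply both to [P] and to the kernel values [Q n w]. *)
Lemma bounded_integrable (R : realType) (d : measure_display)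
    (T : measurableType d) (mu : {measure set T -> \bar R}) (u : T -> R)
    (K : R) :
  mu setT = 1%E ->
  measurable_fun setT u -> (forall x, `|u x| <= K) ->
  mu.-integrable setT (EFin \o u).
Proof.
move=> mu1 mu_ uK; apply: measurable_bounded_integrable => //.
  by rewrite [ltLHS]mu1 ltry.
exists K; split; first exact: num_real.
by move=> x Kx y _ /=; rewrite (le_trans (uK y))// ltW.
Qed.

Lemma Rintegral_cst_probability (R : realType) (d : measure_display)
    (T : measurableType d) (mu : {measure set T -> \bar R}) (r : R) :
  mu setT = 1%E -> \int[mu]_x r = r.
Proof. by move=> mu1; rewrite Rintegral_cst// [X in fine X]mu1 mulr1. Qed.

Lemma normr_Rintegral_le (R : realType) (d : measure_display)
    (T : measurableType d) (mu : {measure set T -> \bar R}) (u : T -> R)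
    (K : R) :
  mu setT = 1%E ->
  measurable_fun setT u -> (forall x, `|u x| <= K) -> `|\int[mu]_x u x| <= K.
Proof.
move=> mu1 mu_ uK.
have iu := bounded_integrable mu1 mu_ uK.
rewrite (le_trans (le_normr_Rintegral _ iu))//.
have -> : K = \int[mu]_(_ in setT) K.
  by rewrite Rintegral_cst_probability.
apply: le_Rintegral => //=.
  apply: (@bounded_integrable _ _ _ mu _ K mu1) => [|x].
    exact: measurableT_comp.
  by rewrite normr_id.
exact: (@bounded_integrable _ _ _ mu _ `|K| mu1).
Qed.

Lemma RintegralB_bounded (R : realType) (d : measure_display)
    (T : measurableType d) (mu : {measure set T -> \bar R}) (u v : T -> R)
    (K L : R) :
  mu setT = 1%E ->
  measurable_fun setT u -> measurable_fun setT v ->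
  (forall x, `|u x| <= K) -> (forall x, `|v x| <= L) ->
  \int[mu]_x (u x - v x) = \int[mu]_x u x - \int[mu]_x v x.
Proof.
move=> mu1 mu_ mv uK vL; apply: RintegralB => //.
- exact: bounded_integrable uK.
- exact: bounded_integrable vL.
Qed.

Lemma le_Rintegral_bounded (R : realType) (d : measure_display)
    (T : measurableType d) (mu : {measure set T -> \bar R}) (u v : T -> R)
    (K L : R) :
  mu setT = 1%E ->
  measurable_fun setT u -> measurable_fun setT v ->
  (forall x, `|u x| <= K) -> (forall x, `|v x| <= L) ->
  (forall x, u x <= v x) -> \int[mu]_x u x <= \int[mu]_x v x.
Proof.
move=> mu1 mu_ mv uK vL uv; apply: le_Rintegral => //.
- exact: bounded_integrable uK.
- exact: bounded_integrable vL.
Qed.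

(** Integrate the pointwise bound [|u| <= eta + K * \1_B]. *)
Lemma normr_Rintegral_le_off (R : realType) (d : measure_display)
    (T : measurableType d) (mu : {measure set T -> \bar R}) (u : T -> R)
    (B : set T) (K eta : R) :
  mu setT = 1%E ->
  measurable_fun setT u -> measurable B -> 0 <= eta ->
  (forall x, `|u x| <= K) ->
  (forall x, ~ B x -> `|u x| <= eta) ->
  `|\int[mu]_x u x| <= eta + K * fine (mu B).
Proof.
move=> mu1 mu_ mB eta0 uK uB.
have iu := bounded_integrable mu1 mu_ uK.
have K0 : T -> 0 <= K by move=> x; exact: le_trans (uK x).
have imB : mu.-integrable setT (EFin \o (\1_B : T -> R)).
  apply: (@bounded_integrable _ _ _ mu _ 1 mu1) => [|x].
    exact: measurable_indic.
  by rewrite indicE; case: (_ \in _); rewrite ?normr1 ?normr0.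
have icst : mu.-integrable setT (EFin \o (fun=> eta)).
  exact: (@bounded_integrable _ _ _ mu _ `|eta| mu1).
have iKB : mu.-integrable setT (EFin \o (fun x => K * \1_B x)).
  exact: (integrableZl measurableT K imB).
rewrite (le_trans (le_normr_Rintegral _ iu))//.
have -> : eta + K * fine (mu B) = \int[mu]_x (eta + K * \1_B x).
  rewrite RintegralD//.
  rewrite Rintegral_cst_probability//.
  have -> : \int[mu]_x (K * \1_B x) = K * \int[mu]_x \1_B x.
    exact: (RintegralZl K measurableT imB).
  by rewrite /Rintegral integral_indic// setIT.
apply: le_Rintegral => //=.
- apply: (@bounded_integrable _ _ _ mu _ K mu1) => [|x].
    exact: measurableT_comp.
  by rewrite normr_id.
- exact: (integrableD measurableT icst iKB).
- move=> x _; rewrite indicE; have [xB|xB] := boolP (x \in B).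
    by rewrite mulr1 ler_wpDl.
  by rewrite mulr0 addr0 uB// => /mem_set xB'; rewrite xB' in xB.
Qed.

(** Adding [K] makes the integrand nonnegative, so that its integral against the kernel is
    measurable in [w]; as [Q w] has mass 1, subtracting [K] undoes the shift. *)
Lemma measurable_Rintegral_kernel (R : realType) (d d' : measure_display)
    (X : measurableType d) (Y : measurableType d') (Q : R.-pker X ~> Y)
    (u : Y -> R) (K : R) :
  measurable_fun setT u -> (forall x, `|u x| <= K) ->
  measurable_fun setT (fun w => \int[Q w]_x u x).
Proof.
move=> mu_ uK.
have -> : (fun w => \int[Q w]_x u x) =
  (fun w => fine (\int[Q w]_x (u x + K)%:E)%E - K).
  apply/funext => w.
  have -> : fine (\int[Q w]_x (u x + K)%:E)%E = \int[Q w]_x (u x + K) by [].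
  have iu := bounded_integrable (prob_kernel w) mu_ uK.
  rewrite RintegralD//; last first.
    exact: (@bounded_integrable _ _ _ (Q w) _ `|K| (prob_kernel w)).
  by rewrite (Rintegral_cst_probability _ (prob_kernel w)) addrK.
apply: measurable_funB => //; apply: measurableT_comp => //.
apply: measurable_fun_integral_kernel.
- by move=> U mU; exact: measurable_kernel.
- by move=> z; rewrite lee_fin; have := uK z; rewrite ler_norml => /andP[]; lra.
- by apply/measurable_EFinP; exact: measurable_funD.
Qed.

(** * Convergence to zero in probability *)

(** Trades the limit for measurable exceptional events that are eventually of probability at most
    [rho]. In this form several convergences are combined by taking unions of events. *)
Lemma oP1P (R : realType) (d : nat -> measure_display)
    (Om : forall n, measurableType (d n))
    (PO : forall n, probability (Om n) R) (X : forall n, Om n -> R) :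
  (forall n, measurable_fun setT (X n)) ->
  oP1 PO X <->
  (forall eps rho : R, 0 < eps -> 0 < rho ->
    exists E : forall n, set (Om n),
      [/\ forall n, measurable (E n),
          forall n w, eps < `|X n w| -> E n w &
          \forall n \near \oo, (PO n (E n) <= rho%:E)%E]).
Proof.
move=> mX.
have mE n (eps : R) : measurable [set w | eps < `|X n w|].
  have : measurable_fun setT (fun w => `|X n w|) by exact: measurableT_comp.
  move=> /(_ measurableT _ (measurable_itv `]eps, +oo[)); rewrite setTI.
  by congr measurable; apply/seteqP; split=> w /=; rewrite in_itv/= andbT.
have fE n (A : set (Om n)) : measurable A -> PO n A \is a fin_num.
  exact: fin_num_measure.
split=> [H eps rho eps0 rho0|H eps eps0].
  exists (fun n => [set w | eps < `|X n w|]); split=> //.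
  have /fine_cvgP[_ /cvgrPdist_le/(_ _ rho0)] := H _ eps0.
  apply: filterS => n /=; rewrite sub0r normrN => le.
  rewrite -[leLHS]fineK ?fE// lee_fin; exact: le_trans (ler_norm _) le.
apply/fine_cvgP; split; first by apply: nearW => n; exact: fE.
apply/cvgrPdist_le => rho rho0.
have [E [mE' sub]] := H _ _ eps0 rho0.
apply: filterS => n /= le; rewrite sub0r normrN ger0_norm ?fine_ge0//.
rewrite -lee_fin fineK ?fE// (le_trans _ le)//.
by apply: le_measure; rewrite ?inE//; exact: sub.
Qed.

(** A union bound: off the exceptional events of the finitely many [Y i], the variable [X n] is at
    most [eps]. The [Y i], their number and [e] may all depend on [eps]. *)
Lemma oP1_approx (R : realType) (d : nat -> measure_display)
    (Om : forall n, measurableType (d n))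
    (PO : forall n, probability (Om n) R) (X : forall n, Om n -> R) :
  (forall n, measurable_fun setT (X n)) ->
  (forall eps : R, 0 < eps ->
    exists (N : nat) (Y : nat -> forall n, Om n -> R) (e : R),
      [/\ forall i n, measurable_fun setT (Y i n), forall i, oP1 PO (Y i),
          0 < e &
          forall n w, (forall i, (i < N)%N -> `|Y i n w| <= e) ->
            `|X n w| <= eps]) ->
  oP1 PO X.
Proof.
move=> mX H; apply/(oP1P PO mX) => eps rho eps0 rho0.
have [N [Y [e [mY oY e0 XY]]]] := H _ eps0.
(* Dividing by [N.+1] covers [N = 0] as well; the [N] events then cost at most [rho] together. *)
have rhoN0 : 0 < rho / N.+1%:R by rewrite divr_gt0.
have /choice[E HE] : forall i, exists E : forall n, set (Om n),
      [/\ forall n, measurable (E n),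
          forall n w, e < `|Y i n w| -> E n w &
          \forall n \near \oo, (PO n (E n) <= (rho / N.+1%:R)%:E)%E].
  by move=> i; exact: (oP1P PO (mY i)).1.
have mE i n : measurable (E i n) by have [] := HE i.
exists (fun n => \big[setU/set0]_(i < N) E i n); split.
- by move=> n; exact: bigsetU_measurable.
- move=> n w; apply: contraPP => nE.
  apply/negP; rewrite -leNgt; apply: XY => i iN.
  rewrite leNgt; apply/negP => eY; apply: nE.
  rewrite -(bigcup_mkord N (E^~ n)); exists i => //.
  by have [_ + _] := HE i; apply.
- have : \forall n \near \oo, forall i : 'I_N,
      (PO n (E i n) <= (rho / N.+1%:R)%:E)%E.
    by apply: filter_forall => i; have [] := HE i.
  apply: filterS => n le.
  rewrite (le_trans (@Boole_inequality _ _ _ (PO n) (E^~ n) N _))//.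
  rewrite (@le_trans _ _ (\sum_(i < N) (rho / N.+1%:R)%:E)%E)//.
    by apply: lee_sum => i _; exact: le.
  rewrite sumEFin lee_fin sumr_const card_ord -[_ *+ N]mulr_natr -mulrA.
  rewrite ler_piMr ?(ltW rho0)//.
  by rewrite ler_pdivrMl// mulr1 ler_nat.
Qed.

(** * Lusin approximation for finite Borel measures *)

(** Continuity from above, available because [m] is finite. *)
Lemma cvg0_measure_le (R : realType) (d : measure_display)
    (T : measurableType d) (m : {finite_measure set T -> \bar R})
    (F : nat -> set T) :
  (forall k, measurable (F k)) -> (forall k l, (k <= l)%N -> F l `<=` F k) ->
  m (\bigcap_k F k) = 0%E ->
  forall delta : R, 0 < delta -> exists k, (m (F k) <= delta%:E)%E.
Proof.
move=> mF decF m0 delta delta0.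
have fm A : measurable A -> m A \is a fin_num by exact: fin_num_measure.
have : (m \o F) @ \oo --> m (\bigcap_k F k).
  apply: nonincreasing_cvg_mu => //.
  - by rewrite ltey_eq fm.
  - exact: bigcapT_measurable.
  - by move=> k l kl; apply/subsetPset; exact: decF.
rewrite m0 => /fine_cvgP[_ /cvgrPdist_le/(_ _ delta0)[k _ /(_ k)]].
move=> /(_ (leqnn k)) /=; rewrite sub0r normrN => le; exists k.
by rewrite -[leLHS]fineK ?fm// lee_fin (le_trans (ler_norm _)).
Qed.

(** Agreement off [B] is exact, and the range of [h] is controlled, so that the property passes to
    sums and, for indicators, to complements and unions. *)
Definition lusin (R : realType) (p : nat)
    (m : {finite_measure set (borelRp R p) -> \bar R}) (K : R)
    (g : 'rV[R]_p -> R) : Prop :=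
  forall delta : R, 0 < delta ->
    exists (B : set (borelRp R p)) (h : 'rV[R]_p -> R),
      [/\ measurable B, (m B <= delta%:E)%E, continuous h,
          forall x, 0 <= h x <= K & forall x, ~ B x -> h x = g x].

Lemma lusinD (R : realType) (p : nat)
    (m : {finite_measure set (borelRp R p) -> \bar R}) (K1 K2 : R)
    (g1 g2 : 'rV[R]_p -> R) :
  lusin m K1 g1 -> lusin m K2 g2 -> lusin m (K1 + K2) (fun x => g1 x + g2 x).
Proof.
move=> L1 L2 delta delta0; have d20 : 0 < delta / 2 by lra.
have [B1 [h1 [mB1 B1d ch1 h1K h1g]]] := L1 _ d20.
have [B2 [h2 [mB2 B2d ch2 h2K h2g]]] := L2 _ d20.
exists (B1 `|` B2), (fun x => h1 x + h2 x); split.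
- exact: measurableU.
- rewrite (le_trans (measureU2 _ mB1 mB2))//.
  by rewrite [in leRHS](splitr delta) EFinD leeD.
- by move=> x; apply: (@continuousD _ _ _ h1 h2 x); [exact: ch1|exact: ch2].
- by move=> x; have := h1K x; have := h2K x; lra.
- by move=> x /not_orP[nB1 nB2]; rewrite h1g// h2g.
Qed.

Lemma continuous1B (R : realType) (V : topologicalType) (h : V -> R) :
  continuous h -> continuous (fun x => 1 - h x).
Proof.
move=> ch x; apply: (@continuousB R R V (fun=> 1) h x).
  exact: cvg_cst.
exact: ch.
Qed.

Lemma lusin_compl (R : realType) (p : nat)
    (m : {finite_measure set (borelRp R p) -> \bar R}) (A : set 'rV[R]_p) :
  lusin m 1 \1_A -> lusin m 1 \1_(~` A).
Proof.
move=> L delta delta0; have [B [h [mB Bd ch hK hg]]] := L _ delta0.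
exists B, (fun x => 1 - h x); split => //.
- exact: continuous1B.
- by move=> x; have := hK x; lra.
- by move=> x /hg ->; rewrite !indicE in_setC; case: (x \in A) => /=; lra.
Qed.

(** The indicator of the union is [1 - (1 - \1_A1) * (1 - \1_A2)]; the same formula applied to
    continuous functions with values in [[0, 1]] stays in [[0, 1]]. *)
Lemma lusin_setU (R : realType) (p : nat)
    (m : {finite_measure set (borelRp R p) -> \bar R}) (A1 A2 : set 'rV[R]_p) :
  lusin m 1 \1_A1 -> lusin m 1 \1_A2 -> lusin m 1 \1_(A1 `|` A2).
Proof.
move=> L1 L2 delta delta0; have d20 : 0 < delta / 2 by lra.
have [B1 [h1 [mB1 B1d ch1 h1K h1g]]] := L1 _ d20.
have [B2 [h2 [mB2 B2d ch2 h2K h2g]]] := L2 _ d20.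
exists (B1 `|` B2), (fun x => 1 - (1 - h1 x) * (1 - h2 x)); split.
- exact: measurableU.
- rewrite (le_trans (measureU2 _ mB1 mB2))//.
  by rewrite [in leRHS](splitr delta) EFinD leeD.
- apply: continuous1B => x.
  by apply: (@continuousM _ _ (fun y => 1 - h1 y) (fun y => 1 - h2 y) x);
    exact: continuous1B.
- by move=> x; have := h1K x; have := h2K x; nra.
- move=> x /not_orP[nB1 nB2]; rewrite h1g// h2g// !indicE in_setU.
  by case: (x \in A1); case: (x \in A2) => /=; lra.
Qed.

(** The Lipschitz envelopes of the indicator increase to it: if the ball of radius [r] around [x]
    lies in [A], they equal 1 at [x] once [k >= 1 / r], and off [A] they vanish. The sets [F k]
    where they differ from the indicator thus decrease to the empty set. *)
Lemma lusin_open (R : realType) (p : nat)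
    (m : {finite_measure set (borelRp R p) -> \bar R}) (A : set 'rV[R]_p) :
  open A -> lusin m 1 \1_A.
Proof.
move=> oA.
have mA : measurable (A : set (borelRp R p)) by exact: sub_gen_smallest.
pose g : 'rV[R]_p -> R := \1_A.
have g0 x : 0 <= g x by rewrite /g indicE.
pose h (k : nat) := lip_env k%:R g.
have ch k : continuous (h k) by apply: (@lip_env_continuous _ _ _ 0).
have h0 k x : 0 <= h k x by apply: lip_env_gem.
have hg k x : h k x <= g x by apply: (@lip_env_lef _ _ _ 0).
have g1 x : g x <= 1 by rewrite /g indicE; case: (x \in A).
pose F k : set (borelRp R p) := A `&` [set x | h k x < 1].
have mF k : measurable (F k).
  apply: measurableI => //.
  have := continuous_borelRp_measurable (ch k).
  move=> /(_ measurableT _ (measurable_itv `]-oo, 1[)); rewrite setTI.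
  by congr measurable; apply/seteqP; split=> w /=; rewrite in_itv.
move=> delta delta0.
have [||k Fk] := @cvg0_measure_le _ _ _ m F mF _ _ delta delta0.
- move=> k l kl x [Ax /= hl]; split => //=; apply: le_lt_trans hl.
  by apply: (@lip_env_homo _ _ _ _ 0) => //; rewrite ler_nat.
- rewrite (_ : \bigcap_k _ = set0) ?measure0// -subset0 => x Fx.
  have [Ax _] := Fx 0%N I.
  have /nbhs_ballP[r /= r0 rA] : nbhs x A by exact: open_nbhs_nbhs.
  have [k kr] : exists k : nat, r^-1 <= k%:R.
    by exists (Num.truncn r^-1).+1; rewrite ltW// truncnS_gt.
  have [_ /=] := Fx k I; apply/negP; rewrite -leNgt.
  apply: (@lip_env_ge_near _ _ _ 0 _ r) => //.
    move=> y yr; rewrite /g indicE mem_set//; apply: rA.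
    by rewrite -ball_normE.
  by rewrite subr0 -ler_pdivrMr// mul1r.
- exists (F k), (h k); split => //.
    by move=> x; rewrite h0 (le_trans (hg k x)).
  move=> x nF; apply/eqP; rewrite eq_le hg/= /g indicE.
  have [xA|xA] := boolP (x \in A); last exact: h0.
  rewrite leNgt; apply/negP => hlt; apply: nF; split => //; exact/set_mem.
Qed.

(** The measurable sets whose indicator has the Lusin property form a sigma-algebra containing the
    open sets. *)
Lemma lusin_indic (R : realType) (p : nat)
    (m : {finite_measure set (borelRp R p) -> \bar R})
    (A : set (borelRp R p)) : measurable A -> lusin m 1 \1_A.
Proof.
suff H : measurable `<=` [set A : set (borelRp R p) |
    measurable A /\ lusin m 1 \1_A] by move=> /H[].
apply: smallest_sub; last first.
  by move=> U oU; split; [exact: sub_gen_smallest|exact: lusin_open].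
have L0 : lusin m 1 \1_(set0 : set 'rV[R]_p) by apply: lusin_open; exact: open0.
split; first by split.
- move=> U [mU LU]; rewrite setTD; split; first exact: measurableC.
  exact: lusin_compl.
- suff HU (U : nat -> set (borelRp R p)) :
      (forall i, measurable (U i) /\ lusin m 1 \1_(U i)) ->
      measurable (\bigcup_i U i) /\ lusin m 1 \1_(\bigcup_i U i).
    by move=> U LU; exact: HU.
  move=> LU.
  have mU i : measurable (U i) by have [] := LU i.
  have mbig n : measurable (\big[setU/set0]_(i < n) U i).
    exact: bigsetU_measurable.
  have mcup : measurable (\bigcup_i U i) by exact: bigcupT_measurable.
  split => // delta delta0; have d20 : 0 < delta / 2 by lra.
  have LN n : lusin m 1 \1_(\big[setU/set0]_(i < n) U i : set 'rV[R]_p).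
    elim: n => [|n IH]; first by rewrite big_ord0.
    by rewrite big_ord_recr/=; apply: lusin_setU => //; have [] := LU n.
  (* What the first [n] sets leave of the union decreases to the empty set. Some remainder has
     measure at most [delta / 2], and the finite union is approximated with the other half. *)
  have [|||n Tn] := @cvg0_measure_le _ _ _ m
    (fun n => (\bigcup_i U i) `\` \big[setU/set0]_(i < n) U i) _ _ _ _ d20.
  + by move=> n; exact: measurableD.
  + move=> k l kl; apply: setDS; exact: subset_bigsetU.
  + rewrite (_ : \bigcap_k _ = set0) ?measure0// -subset0 => x Tx.
    have [[i _ Uix] _] := Tx 0%N I.
    have [_] := Tx i.+1 I; apply; rewrite -bigcup_mkord.
    by exists i => /=.
  + have [B [h [mB Bd ch hK hg]]] := LN n _ d20.
    exists (B `|` ((\bigcup_i U i) `\` \big[setU/set0]_(i < n) U i)), h.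
    split => //.
    * by apply: measurableU => //; exact: measurableD.
    * rewrite (le_trans (measureU2 _ mB _))//; first exact: measurableD.
      by rewrite [in leRHS](splitr delta) EFinD leeD.
    * move=> x /not_orP[nB nT]; rewrite hg// !indicE; congr (_%:R).
      congr nat_of_bool; apply/idP/idP => /set_mem xU; apply/mem_set.
        by move: xU; rewrite -bigcup_mkord => -[i _ Ui]; exists i.
      by apply: contrapT => xn; apply: nT.
Qed.

(** Lusin approximation for the sum of two measures gives one exceptional set that is small for
    both. *)
Lemma finite_measure_add (R : realType) (d : measure_display)
    (T : measurableType d) (m1 m2 : {finite_measure set T -> \bar R}) :
  exists m : {finite_measure set T -> \bar R},
    forall A, m A = (m1 A + m2 A)%E.
Proof.
have fin : fin_num_fun (measure_add m1 m2).
  by move=> A mA; rewrite measure_addE fin_numD !fin_num_measure.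
pose m12 : {measure set T -> \bar R} := measure_add m1 m2.
pose mfin := @Measure_isFinite.Build _ _ _ m12 fin.
pose m : {finite_measure set T -> \bar R} := HB.pack (Measure.sort m12) mfin.
by exists m => A; rewrite -measure_addE.
Qed.

Lemma lusin_sum (R : realType) (p : nat)
    (m : {finite_measure set (borelRp R p) -> \bar R})
    (g : nat -> 'rV[R]_p -> R) (N : nat) :
  (forall j, lusin m 1 (g j)) -> lusin m N%:R (fun x => \sum_(j < N) g j x).
Proof.
move=> Lg; elim: N => [|N IH].
  move=> delta delta0; exists set0, (fun=> 0); split => //.
  - by rewrite measure0 lee_fin ltW.
  - exact: cst_continuous.
  - by move=> x; rewrite lexx.
  - by move=> x _; rewrite big_ord0.
rewrite -natr1 (_ : (fun x => _) = (fun x => \sum_(j < N) g j x + g N x)).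
  exact: lusinD.
by apply/funext => x; rewrite big_ord_recr.
Qed.

(** The sum counts the levels [eta, ..., N * eta] reached by [y], so [eta * s] rounds [y] down to a
    level. In the induction, either the top level is reached and all terms are 1, or the last term
    is 0. *)
Lemma staircase (R : realType) (N : nat) (eta y : R) :
  0 < eta -> 0 <= y <= N.+1%:R * eta ->
  let s := \sum_(j < N) (j.+1%:R * eta <= y)%R%:R in
  eta * s <= y <= eta * s + eta.
Proof.
move=> eta0; elim: N => [|N IH] yN /=.
  by rewrite big_ord0; move: yN; rewrite mul1r; lra.
have [yge|ylt] := leP (N.+1%:R * eta) y.
  rewrite (eq_bigr (fun=> 1)); last first.
    move=> j _; rewrite (_ : _ <= y)// (le_trans _ yge)// ler_pM2r// ler_nat.
    exact: ltn_ord.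
  rewrite sumr_const card_ord -[_ *+ _]/(N.+1%:R).
  by move: yN; rewrite -[N.+2%:R]natr1; nra.
have nle : (N.+1%:R * eta <= y) = false by rewrite leNgt ylt.
rewrite big_ord_recr/= nle addr0; apply: IH.
by case/andP: yN => -> _; exact: ltW.
Qed.

(** The function [f + M], with values in [[0, 2M]], is within [t] of a staircase built from
    indicators of its superlevel sets [A j], and such a sum has the Lusin property. *)
Lemma lusin_bounded (R : realType) (p : nat)
    (m : {finite_measure set (borelRp R p) -> \bar R})
    (f : 'rV[R]_p -> R) (M eta delta : R) :
  measurable_fun [set: borelRp R p] f -> 0 < M -> (forall x, `|f x| <= M) ->
  0 < eta -> 0 < delta ->
  exists (B : set (borelRp R p)) (h : 'rV[R]_p -> R),
    [/\ measurable B, (m B <= delta%:E)%E, continuous h,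
        forall x, `|h x| <= M & forall x, ~ B x -> `|f x - h x| <= eta].
Proof.
move=> mf M0 fM eta0 delta0.
(* [N] is large enough for the step [t] to be at most [eta], while [N * t = 2 * M] holds exactly, so
   that [t * h - M] stays in [[-M, M]]. *)
pose N := (Num.truncn (2 * M / eta)).+1.
have N0 : 0 < N%:R :> R by rewrite ltr0n.
pose t := 2 * M / N%:R.
have t0 : 0 < t by rewrite divr_gt0// mulr_gt0.
have Nt : N%:R * t = 2 * M by rewrite mulrC divfK// gt_eqF.
have teta : t <= eta.
  by rewrite ler_pdivrMr// [leRHS]mulrC -ler_pdivrMr//;
    exact: ltW (truncnS_gt _).
pose A j : set (borelRp R p) := [set x | j.+1%:R * t <= f x + M].
have mA j : measurable (A j).
  have mfM : measurable_fun [set: borelRp R p] (fun x => f x + M).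
    exact: measurable_funD.
  have := mfM measurableT _ (measurable_itv `[j.+1%:R * t, +oo[).
  by rewrite setTI; congr measurable; apply/seteqP; split=> w /=;
    rewrite in_itv/= andbT.
have [B [h [mB Bd ch hN hs]]] :=
  lusin_sum N (fun j => lusin_indic m (mA j)) delta0.
exists B, (fun x => t * h x - M); split => //.
- move=> x; apply: (@continuousB R R _ (fun y => t * h y) (fun=> M) x).
    apply: (@continuousM R _ (fun=> t) h x); last exact: ch.
    exact: cst_continuous.
  exact: cst_continuous.
- by move=> x; rewrite ler_norml; have := hN x; nra.
- move=> x /hs ->.
  rewrite (eq_bigr (fun j : 'I_N => (j.+1%:R * t <= f x + M)%R%:R)); last first.
    move=> j _; rewrite indicE; congr (_%:R); congr nat_of_bool.
    by apply/idP/idP => [/set_mem|le]; last by apply: mem_set; exact: le.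
  have := fM x; rewrite ler_norml => /andP[f1 f2].
  have := @staircase R N t (f x + M) t0.
  rewrite -[N.+1%:R]natr1 mulrDl mul1r Nt => /(_ _)/= -/(_ ltac:(lra)).
  by rewrite ler_norml; lra.
Qed.

(** * Convergence of integrals for almost surely continuous functions *)

Lemma oP1_ae_continuous (R : realType) (p : nat)
    (P : probability (borelRp R p) R) (d : nat -> measure_display)
    (Om : forall n, measurableType (d n))
    (PO : forall n, probability (Om n) R)
    (Q : forall n, R.-pker (Om n) ~> borelRp R p)
    (f : 'rV[R]_p -> R) (M : R) :
  weak_cvg_in_prob PO Q P ->
  measurable_fun [set: borelRp R p] f -> 0 < M -> (forall x, `|f x| <= M) ->
  {ae P, forall x, {for (x : 'rV[R]_p), continuous f}} ->
  oP1 PO (fun n w => \int[Q n w]_x f x - \int[P]_x f x).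
Proof.
move=> wQ mf M0 fM [N [mN N0 subN]].
have P1 : P setT = 1%E by exact: probability_setT.
have Q1 n w : Q n w setT = 1%E by exact: prob_kernel.
have mfun (h : 'rV[R]_p -> R) : measurable_fun [set: borelRp R p] h ->
    (forall x, `|h x| <= M) ->
    forall n, measurable_fun setT (fun w => \int[Q n w]_x h x - \int[P]_x h x).
  move=> mh hM n; apply: measurable_funB => //.
  exact: measurable_Rintegral_kernel mh hM.
have lbf g : (forall x, `|g x| <= M) -> forall x : 'rV[R]_p, - M <= g x.
  by move=> gM x; have := gM x; rewrite ler_norml => /andP[].
have envP g k : (forall x, `|g x| <= M) ->
    [/\ continuous (lip_env k%:R g), forall x, lip_env k%:R g x <= g x &
        forall x : 'rV[R]_p, `|lip_env k%:R g x| <= M].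
  move=> gM; have gm := lbf _ gM.
  have le x : lip_env k%:R g x <= g x by exact: lip_env_lef gm.
  split=> //; first exact: lip_env_continuous gm.
  move=> x; rewrite ler_norml (lip_env_gem x _ gm)//=.
  by rewrite (le_trans (le x))// (le_trans (ler_norm _)).
have fM' x : `|- f x| <= M by rewrite normrN.
pose l k := lip_env k%:R f; pose u k x := - lip_env k%:R (fun y => - f y) x.
have cl k : continuous (l k) by have [] := envP f k fM.
have cu k : continuous (u k).
  have [c _ _] := envP _ k fM'.
  by move=> x; apply: (@continuousN _ R _ _ x); exact: c.
have lf k x : l k x <= f x by have [_ + _] := envP f k fM; apply.
have fu k x : f x <= u k x.
  by have [_ + _] := envP _ k fM' => /(_ x); rewrite /u; lra.
have lM k x : `|l k x| <= M by have [_ _] := envP f k fM; apply.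
have uM k x : `|u k x| <= M.
  by have [_ _] := envP _ k fM'; rewrite /u normrN; apply.
have ml k := continuous_borelRp_measurable (cl k).
have mu_ k := continuous_borelRp_measurable (cu k).
apply: oP1_approx; first exact: mfun mf fM.
move=> eps eps0.
(* With [P (F k) <= eps / (8 * M)] and [u k - l k] at most [2 * M], the integral of the gap is at
   most [eps / 4 + eps / 4]. *)
pose F k : set (borelRp R p) := [set x | eps / 4 < u k x - l k x].
have mul k : measurable_fun [set: borelRp R p] (fun x => u k x - l k x).
  exact: measurable_funB.
have mF k : measurable (F k).
  have := mul k measurableT _ (measurable_itv `]eps / 4, +oo[).
  by rewrite setTI; congr measurable; apply/seteqP; split=> w /=;
    rewrite in_itv/= andbT.
have delta0 : 0 < eps / (8 * M) by rewrite divr_gt0// mulr_gt0.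
have [k k' kk' x Fx||k Fk] := @cvg0_measure_le _ _ _ P F mF _ _ _ delta0.
- apply: lt_le_trans Fx _.
  have kk : k%:R <= k'%:R :> R by rewrite ler_nat.
  have := @lip_env_homo _ _ _ _ _ f x (ler0n _ k) kk (lbf _ fM).
  have := @lip_env_homo _ _ _ _ _ _ x (ler0n _ k) kk (lbf _ fM').
  by rewrite /u /l; lra.
(* The intersection of the [F k] lies in the null set [N]: if [f] varies by less than [eps / 8] on a
   ball of radius [r] around [x], then for [k >= 2M / r] both envelopes are within [eps / 8] of
   [f x], so [x] is not in [F k]. *)
- apply/eqP; rewrite eq_le measure_ge0 andbT -N0.
  apply: le_measure; rewrite ?inE//; first exact: bigcapT_measurable.
  move=> x Fx; apply: subN => cx.
  have e8 : 0 < eps / 8 by rewrite divr_gt0.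
  have /cvgrPdist_lt/(_ _ e8)/nbhs_ballP[r /= r0 rf] := cx.
  have [k kr] : exists k : nat, (M + M) / r <= k%:R.
    by exists (Num.truncn ((M + M) / r)).+1; exact: ltW (truncnS_gt _).
  have {}kr : M + M <= k%:R * r by rewrite -ler_pdivrMr.
  have rf' y : `|x - y| < r -> `|f x - f y| < eps / 8.
    by move=> xy; apply: rf; rewrite -ball_normE.
  have := Fx k I; rewrite /F/= /u /l ltNge => /negP; apply.
  have := fM x; rewrite ler_norml => /andP[f1 f2].
  have H1 : f x - eps / 8 <= lip_env k%:R f x.
    apply: (lip_env_ge_near (r := r) _ (lbf _ fM)) => //; last lra.
    by move=> y /rf'; rewrite ltr_norml; lra.
  have H2 : - f x - eps / 8 <= lip_env k%:R (fun y => - f y) x.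
    apply: (lip_env_ge_near (r := r) _ (lbf _ fM')) => //; last lra.
    by move=> y /rf'; rewrite ltr_norml; lra.
  lra.
have Pul : \int[P]_x u k x - \int[P]_x l k x <= eps / 2.
  rewrite -(RintegralB_bounded P1 (mu_ k) (ml k) (uM k) (lM k)).
  apply: le_trans (ler_norm _) _.
  apply: (le_trans (normr_Rintegral_le_off (K := 2 * M) (eta := eps / 4)
    P1 (mul k) (mF k) _ _ _)).
  - by rewrite ltW// divr_gt0.
  - move=> x; rewrite (le_trans (ler_normB _ _))//.
    by have := uM k x; have := lM k x; lra.
  - move=> x /negP; rewrite -leNgt => h; rewrite ger0_norm//.
    by have := lf k x; have := fu k x; lra.
  - have : fine (P (F k)) <= eps / (8 * M).
      by rewrite -lee_fin fineK// fin_num_measure.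
    rewrite ler_pdivlMr; last lra.
    lra.
(* Index 0 is the upper envelope and index 1 the lower one. The squeeze costs [eps / 2] for their
   deviations and [eps / 2] for the gap under [P]. *)
exists 2%N, (fun i n w => if i is 0%N then \int[Q n w]_x u k x - \int[P]_x u k x
  else \int[Q n w]_x l k x - \int[P]_x l k x), (eps / 2); split.
- by case=> [|i]; apply: mfun.
- by case=> [|i]; apply: wQ => //; exists M.
- by rewrite divr_gt0.
- move=> n w H; have := H 0%N isT; have := H 1%N isT => /=.
  have := le_Rintegral_bounded (Q1 n w) mf (mu_ k) fM (uM k) (fu k).
  have := le_Rintegral_bounded (Q1 n w) (ml k) mf (lM k) fM (lf k).
  have := le_Rintegral_bounded P1 mf (mu_ k) fM (uM k) (fu k).
  have := le_Rintegral_bounded P1 (ml k) mf (lM k) fM (lf k).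
  rewrite !ler_norml; lra.
Qed.

(** * Convergence of integrals under uniform absolute continuity *)

Lemma oP1_unif_abs_cont (R : realType) (p : nat)
    (P : probability (borelRp R p) R) (d : nat -> measure_display)
    (Om : forall n, measurableType (d n))
    (PO : forall n, probability (Om n) R)
    (Q : forall n, R.-pker (Om n) ~> borelRp R p)
    (nu : {finite_measure set (borelRp R p) -> \bar R})
    (f : 'rV[R]_p -> R) (M : R) :
  weak_cvg_in_prob PO Q P -> unif_abs_cont_in_prob PO Q nu ->
  measurable_fun [set: borelRp R p] f -> 0 < M -> (forall x, `|f x| <= M) ->
  oP1 PO (fun n w => \int[Q n w]_x f x - \int[P]_x f x).
Proof.
move=> wQ [mS acQ] mf M0 fM.
have P1 : P setT = 1%E by exact: probability_setT.
have Q1 n w : Q n w setT = 1%E by exact: prob_kernel.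
have mfun (h : 'rV[R]_p -> R) : measurable_fun [set: borelRp R p] h ->
    (forall x, `|h x| <= M) ->
    forall n, measurable_fun setT (fun w => \int[Q n w]_x h x - \int[P]_x h x).
  move=> mh hM n; apply: measurable_funB => //.
  exact: measurable_Rintegral_kernel mh hM.
apply/oP1P; first exact: mfun mf fM.
move=> eps rho eps0 rho0.
have rho20 : 0 < rho / 2 by rewrite divr_gt0.
(* As [|f - h| <= 2 * M], a set of mass [e] contributes at most [eps / 8]. With the uniform error
   [eps / 8], replacing [f] by [h] costs [eps / 4] under each of [Q n w] and [P]. *)
pose e := eps / (16 * M).
have e0 : 0 < e by rewrite divr_gt0// mulr_gt0.
(* The bound [delta <= e] serves [P], for which [P B <= delta] comes directly from the choice of
   [B]. *)
have [delta [delta0 deltae Sdelta]] : exists delta : R, [/\ 0 < delta,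
    delta <= e & \forall n \near \oo,
      (PO n [set w | (e%:E < sup_small nu (Q n w) delta)%E] <= (rho / 2)%:E)%E].
  have : \forall x \near 0^'+, (limn_esup (fun n =>
      PO n [set w | (e%:E < sup_small nu (Q n w) x)%E]) < (rho / 2)%:E)%E.
    apply: (acQ _ e0 [set y | (y < (rho / 2)%:E)%E]).
    by apply: (@open_nbhs_nbhs _ 0%E [set y | (y < (rho / 2)%:E)%E]); split;
      [exact: open_ereal_lt_ereal|rewrite /= lte_fin].
  move=> H; near (0 : R)^'+ => delta; exists delta; split.
  - by [].
  - by near: delta; exact: nbhs_right_le.
  - have : (limn_esup (fun n =>
      PO n [set w | (e%:E < sup_small nu (Q n w) delta)%E]) < (rho / 2)%:E)%E.
      by near: delta.
    (* The limsup is an infimum, over neighbourhoods of infinity, of suprema; being strictly below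
       [rho / 2], it provides a neighbourhood on which every term is. *)
    move=> /ereal_inf_lt[_ [V nV <-] Vlt]; apply: filterS nV => n Vn.
    by rewrite (le_trans _ (ltW Vlt))//; apply: ereal_sup_ubound; exists n.
have [m mE] := finite_measure_add nu P.
have eps80 : 0 < eps / 8 by rewrite divr_gt0.
have [B [h [mB Bd ch hM fh]]] := lusin_bounded m mf M0 fM eps80 delta0.
have mh := continuous_borelRp_measurable ch.
have nuB : (nu B <= delta%:E)%E.
  by rewrite (le_trans _ Bd)// mE leeDl.
have PB : (P B <= delta%:E)%E.
  by rewrite (le_trans _ Bd)// mE leeDr.
have close (mu : {measure set (borelRp R p) -> \bar R}) : mu setT = 1%E ->
    (mu B <= e%:E)%E -> `|\int[mu]_x f x - \int[mu]_x h x| <= eps / 4.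
  move=> mu1 muB; rewrite -(RintegralB_bounded mu1 mf mh fM hM).
  apply: (le_trans (normr_Rintegral_le_off (K := 2 * M) (eta := eps / 8)
    mu1 _ mB _ _ _)) => //.
  - exact: measurable_funB.
  - exact: ltW.
  - move=> x; rewrite (le_trans (ler_normB _ _))//.
    by have := fM x; have := hM x; lra.
  - have : fine (mu B) <= e.
      rewrite -lee_fin fineK// ge0_fin_numE//; exact: le_lt_trans muB (ltry _).
    by rewrite /e ler_pdivlMr; lra.
have /oP1P := wQ h ch (ex_intro _ M hM).
move=> /(_ (mfun h mh hM) (eps / 4) (rho / 2)).
case=> [||E [mE' subE PE]]; [lra|lra|].
have mSE n : measurable [set w | (e%:E < sup_small nu (Q n w) delta)%E].
  have := mS n _ delta0 measurableT _ (emeasurable_itv `]e%:E, +oo[).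
  by rewrite setTI; congr measurable; apply/seteqP; split=> w /=;
    rewrite in_itv/= andbT.
exists (fun n => [set w | (e%:E < sup_small nu (Q n w) delta)%E] `|` E n).
split.
- by move=> n; exact: measurableU.
- move=> n w; apply: contraPP => /not_orP[/negP nS nE].
  apply/negP; rewrite -leNgt.
  (* Since [nu B <= delta], the set [B] competes in the supremum, which is at most [e] outside the
     first event. *)
  have QB : (Q n w B <= e%:E)%E.
    move: nS; rewrite -leNgt; apply: le_trans.
    by apply: ereal_sup_ubound; exists B.
  have hE : `|\int[Q n w]_x h x - \int[P]_x h x| <= eps / 4.
    by rewrite leNgt; apply/negP => /subE.
  have := close _ (Q1 n w) QB.
  have := close _ P1 (le_trans PB (_ : delta%:E <= e%:E)%E).
  rewrite lee_fin => /(_ deltae).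
  by move: hE; rewrite !ler_norml; lra.
- apply: filterS2 Sdelta PE => n S1 E1.
  rewrite (le_trans (measureU2 _ (mSE n) (mE' n)))//.
  by rewrite [in leRHS](splitr rho) EFinD leeD.
Unshelve. all: by end_near. Qed.

(** * From integrals to covariances *)

Theorem theorem2p2 (R : realType) (p : nat)
  (P : probability (borelRp R p) R)
  (d : nat -> measure_display)
  (Om : forall n : nat, measurableType (d n))
  (PO : forall n : nat, probability (Om n) R)
  (Q : forall n : nat, R.-pker (Om n) ~> borelRp R p)
  (F : set ('rV[R]_p -> R))
  (F_meas : forall f, F f -> measurable_fun [set: borelRp R p] f)
  (F_env : bounded_envelope F)
  (hyp :
     (weak_cvg_in_prob PO Q P /\
      (forall f, F f -> {ae P, forall x, {for (x : 'rV[R]_p), continuous f}}))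
     \/
     (weak_cvg_in_prob PO Q P /\
      (exists nu : {finite_measure set (borelRp R p) -> \bar R},
         P `<< nu /\ unif_abs_cont_in_prob PO Q nu)))
  (f g : 'rV[R]_p -> R) (Ff : F f) (Fg : F g) :
  oP1 PO (fun n w =>
    (\int[Q n w]_x (f x * g x) - \int[Q n w]_x f x * \int[Q n w]_x g x)
    - (\int[P]_x (f x * g x) - \int[P]_x f x * \int[P]_x g x)).
Proof.
have [M M0 FM] : exists2 M : R, 0 < M & forall h, F h -> forall x, `|h x| <= M.
  (* Adding 1 makes the bound strictly positive, even if the envelope vanishes. *)
  have [E [M EM] FE] := F_env; exists (M + 1).
    by have := EM 0; have := normr_ge0 (E 0); lra.
  move=> h Fh x; have := FE _ Fh x; have := EM x; have := ler_norm (E x); lra.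
have [fM gM] := (FM _ Ff, FM _ Fg).
have [mf mg] := (F_meas _ Ff, F_meas _ Fg).
have mfg : measurable_fun [set: borelRp R p] (fun x => f x * g x).
  exact: measurable_funM.
have fgM x : `|f x * g x| <= M * M by rewrite normrM ler_pM.
have MM0 : 0 < M * M by rewrite mulr_gt0.
have [of_ og ofg] : [/\ oP1 PO (fun n w => \int[Q n w]_x f x - \int[P]_x f x),
    oP1 PO (fun n w => \int[Q n w]_x g x - \int[P]_x g x) &
    oP1 PO (fun n w => \int[Q n w]_x (f x * g x) - \int[P]_x (f x * g x))].
  case: hyp => [[wQ Fc]|[wQ [nu [_ acQ]]]].
    have [cf cg] := (Fc _ Ff, Fc _ Fg).
    split; [exact: oP1_ae_continuous fM cf|exact: oP1_ae_continuous gM cg|].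
    apply: (oP1_ae_continuous wQ mfg MM0 fgM).
    move: cf cg; apply: (@filterS2 _ _ (ae_filter_ringOfSetsType P)) => x.
    exact: continuousM.
  split; [exact: oP1_unif_abs_cont acQ mf _ fM|
          exact: oP1_unif_abs_cont acQ mg _ gM|
          exact: oP1_unif_abs_cont acQ mfg _ fgM].
have mI (h : 'rV[R]_p -> R) K n : measurable_fun [set: borelRp R p] h ->
    (forall x, `|h x| <= K) -> measurable_fun setT (fun w => \int[Q n w]_x h x).
  exact: measurable_Rintegral_kernel.
have mB (h : 'rV[R]_p -> R) K n : measurable_fun [set: borelRp R p] h ->
    (forall x, `|h x| <= K) ->
    measurable_fun setT (fun w => \int[Q n w]_x h x - \int[P]_x h x).
  by move=> mh hK; apply: measurable_funB => //; exact: mI mh hK.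
apply: oP1_approx => [n|eps eps0].
  apply: measurable_funB => //; apply: measurable_funB; first exact: mI mfg fgM.
  by apply: measurable_funM; [exact: mI mf fM|exact: mI mg gM].
have D0 : 0 < 2 * M + 1 by lra.
(* If all three deviations are at most [t = eps / (2 * M + 1)], the covariance error is at most
   [t + M * t + M * t = eps]. *)
exists 3%N, (fun i n w => match i with
  | 0%N => \int[Q n w]_x (f x * g x) - \int[P]_x (f x * g x)
  | 1%N => \int[Q n w]_x f x - \int[P]_x f x
  | _ => \int[Q n w]_x g x - \int[P]_x g x end), (eps / (2 * M + 1)); split.
- by case=> [|[|i]] n; [exact: mB mfg fgM|exact: mB mf fM|exact: mB mg gM].
- by case=> [|[|i]].
- by rewrite divr_gt0.
- move=> n w H; have := H 0%N isT; have := H 1%N isT; have := H 2%N isT => /=.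
  have := normr_Rintegral_le (@prob_kernel _ _ _ _ _ (Q n) w) mg gM.
  have := normr_Rintegral_le (probability_setT P) mf fM.
  move: (\int[Q n w]_x (f x * g x)) (\int[Q n w]_x f x) (\int[Q n w]_x g x).
  move: (\int[P]_x (f x * g x)) (\int[P]_x f x) (\int[P]_x g x).
  move=> c a b c' a' b' aM b'M bb aa cc.
  set t := eps / (2 * M + 1) in aa bb cc.
  have tE : eps = t + M * t + M * t.
    by rewrite -[LHS](divfK (lt0r_neq0 D0)) -/t; ring.
  (* Primes mark integrals under [Q n w]. Splitting [a' * b' - a * b] in this way leaves the factors
     [b'] and [a], both bounded by [M]. *)
  rewrite (_ : _ - _ - _ = (c' - c) - (a' - a) * b' - a * (b' - b));
    last by ring.
  rewrite tE (le_trans (ler_normB _ _))// lerD//; last by rewrite normrM ler_pM.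
  rewrite (le_trans (ler_normB _ _))// lerD//.
  by rewrite normrM mulrC ler_pM.
Qed.
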